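(* Let $(X,d,\mu,\mathcal{E},\mathcal{F})$ be a Dirichlet space satisfying the standing assumptions (A1)–(A3), (HK), (BE) stated in the context, and let $0<\delta<1$. Let $1\leq p<\infty$ and $\alpha>1/p$. Then $\mathbf{B}^{p,\alpha}(X)$ only contains the zero function.
   Context: Setting. $(X,d,\mu)$ is a locally compact metric measure space, $\mu$ a Radon measure supported on $X$, and $(\mathcal{E},\mathcal{F})$ is a Dirichlet form on $L^2(X,\mu)$ with heat semigroup $\{P_t\}_{t>0}$ and generator $L$. Write $B(x,r)=\{y: d(x,y)<r\}$. For $\lambda>0$, $1\le p<\infty$, $KS^{\lambda,p}(X)$ is the set of $f\in L^p(X,\mu)$ with $\limsup_{r\to0^+}\int_X\int_{B(x,r)}\frac{|f(x)-f(y)|^p}{r^{\lambda p}\mu(B(x,r))}d\mu(y)d\mu(x)<\infty$. Standing assumptions. (A1) Every ball $B(x,r)$ has compact closure. (A2) There are $c_1,c_2,d_H>0$ with $c_1r^{d_H}\le\mu(B(x,r))\le c_2r^{d_H}$ for all $x\in X$, $r\ge0$. (A3) $(\mathcal{E},\mathcal{F})$ is regular and strongly local. (HK) $\{P_t\}$ has a continuous heat kernel $p_t(x,y)$ and there are $c_3,c_4,c_5,c_6\in(0,\infty)$, $d_W\in[2,\infty)$ with $c_5t^{-d_H/d_W}\exp(-c_6(d(x,y)^{d_W}/t)^{1/(d_W-1)})\le p_t(x,y)\le c_3t^{-d_H/d_W}\exp(-c_4(d(x,y)^{d_W}/t)^{1/(d_W-1)})$ for $\mu\times\mu$-a.e.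 $(x,y)$ and every $t>0$. (BE) There is $C>0$ such that $|P_tg(x)-P_tg(y)|\le C\frac{d(x,y)^\kappa}{t^{\kappa/d_W}}\|g\|_{L^\infty(X,\mu)}$ for all $t>0$, $g\in L^\infty(X,\mu)$, $x,y\in X$, where $0<\kappa<d_W$ is defined by $d_W-\kappa=\sup\{\lambda>0: KS^{\lambda,1}(X)\text{ contains non-constant functions}\}$. Subordinated semigroup. For fixed $0<\delta<1$ let $\eta^{(\delta)}_t\ge0$ be the continuous function with $\int_0^\infty\eta^{(\delta)}_t(s)e^{-s\lambda}ds=e^{-t\lambda^\delta}$ for $\lambda>0$. The semigroup with generator given by the fractional Laplacian $(-L)^\delta$ is $P^{(\delta)}_tf=\int_0^\infty\eta^{(\delta)}_t(s)P_sf\,ds$, with heat kernel $p^{(\delta)}_t(x,y)=\int_0^\infty\eta^{(\delta)}_t(s)p_s(x,y)ds$. Besov classes. For $p\ge1$, $\alpha\ge0$: $\|f\|_{p,\alpha}=\sup_{t>0}t^{-\alpha}\left(\int_X\int_X|f(x)-f(y)|^pp^{(\delta)}_t(x,y)d\mu(x)d\mu(y)\right)^{1/p}$ and $\mathbf{B}^{p,\alpha}(X)=\{f\in L^p(X,\mu):\|f\|_{p,\alpha}<\infty\}$. *)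

(* Defs.v *)
From HB Require Import structures.
From mathcomp Require Import all_boot all_order all_algebra.
From mathcomp Require Import all_classical all_reals all_analysis.

Set Implicit Arguments.
Unset Strict Implicit.
Unset Printing Implicit Defensive.

Import Order.TTheory GRing.Theory Num.Theory.
Import numFieldNormedType.Exports.

Local Open Scope classical_set_scope.
Local Open Scope ring_scope.

(* The base point is only there because measurable types are pointed. *)
#[short(type="pmetricType")]
HB.structure Definition PointedMetric (K : numDomainType) :=
  {M of Pointed M & Metric K M}.

Notation borel X := (g_sigma_algebraType (@open X)).

Section MetricMeasureSpace.
Context {R : realType} {X : pmetricType R}.
Variable mu : {measure set (borel X) -> \bar R}.

Definition radon : Prop :=
  [/\ forall K : set X, compact K -> (mu K < +oo)%E,
      forall A : set (borel X), measurable A ->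
        mu A = ereal_inf [set mu U | U in [set U : set X | open U /\ A `<=` U]]
    & forall U : set X, open U ->
        mu U = ereal_sup [set mu K | K in [set K : set X | compact K /\ K `<=` U]]].

Definition full_support : Prop :=
  forall U : set X, open U -> U !=set0 -> (0 < mu U)%E.

Definition ahlfors_regular (dH : R) : Prop :=
  exists c1 c2 : R, [/\ 0 < c1, 0 < c2 &
    forall (x : X) (r : R), 0 <= r ->
      ((c1 * r `^ dH)%:E <= mu (ball x r))%E /\
      (mu (ball x r) <= (c2 * r `^ dH)%:E)%E].

(* [1 / mu (B(x, r))] is taken in [R] through [fine]: no information is lost,
   as balls have finite positive measure under the standing assumptions. *)
Definition korevaar_schoen (lambda p : R) : set (X -> R) :=
  [set f | f \in Lfun mu p%:E /\
    (limf_esup (fun r : R =>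
       \int[mu]_x \int[mu]_(y in ball x r)
         (`|f x - f y| `^ p / (r `^ (lambda * p) * fine (mu (ball x r))))%:E)
       (0 : R)^'+ < +oo)%E].

Definition ae_constant (f : X -> R) : Prop :=
  exists c : R, f = cst c %[ae mu].

Definition is_critical_exponent (l : R) : Prop :=
  l%:E = ereal_sup [set lambda%:E | lambda in [set lambda : R | 0 < lambda /\
           exists2 f, korevaar_schoen lambda 1 f & ~ ae_constant f]].

(* Elements of L^2 are represented by functions, up to [%[ae mu]]. *)

Definition l2dot (f g : X -> R) : R := \int[mu]_x (f x * g x).

Definition l2norm (f : X -> R) : \bar R := 'N[mu]_2%:E[EFin \o f]%E.

Section Form.
Variables (E : (X -> R) -> (X -> R) -> R) (F : set (X -> R)).

Definition energy1 (f : X -> R) : R := E f f + l2dot f f.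

Record dirichlet_form : Prop := {
  df_L2 : forall f, F f -> f \in Lfun mu 2%:E ;
  df_ae : forall f g, F f -> measurable_fun [set: borel X] g ->
    f = g %[ae mu] -> F g /\ forall h, F h -> E f h = E g h ;
  df_dom0 : F (cst 0) ;
  df_domD : forall (a : R) f g, F f -> F g -> F (fun x => a * f x + g x) ;
  df_dense : forall f, f \in Lfun mu 2%:E -> forall e : R, 0 < e ->
    exists2 g, F g & (l2norm (f \- g)%R < e%:E)%E ;
  df_sym : forall f g, F f -> F g -> E f g = E g f ;
  df_lin : forall (a : R) f g h, F f -> F g -> F h ->
    E (fun x => a * f x + g x) h = a * E f h + E g h ;
  df_ge0 : forall f, F f -> 0 <= E f f ;
  df_closed : forall u : nat -> X -> R, (forall n, F (u n)) ->
    (forall e : R, 0 < e -> exists N : nat, forall m n : nat,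
       (N <= m)%N -> (N <= n)%N -> energy1 (u m \- u n) < e) ->
    exists2 f, F f & energy1 (u n \- f) @[n --> \oo] --> (0 : R) ;
  df_markov : forall f, F f ->
    let g := fun x => Num.min (Num.max (f x) 0) 1 in
    F g /\ E g g <= E f f }.

Definition compactly_supported_continuous : set (X -> R) :=
  [set f | continuous f /\ compact (closure [set x | f x != 0])].

Definition regular_form : Prop :=
  (forall f, F f -> forall e : R, 0 < e ->
     exists g, [/\ F g, compactly_supported_continuous g &
                   energy1 (f \- g) < e]) /\
  (forall f, compactly_supported_continuous f -> forall e : R, 0 < e ->
     exists g, [/\ F g, compactly_supported_continuous g &
                   forall x, `|f x - g x| < e]).

(* The support of the measure [f mu]. *)
Definition esupport (f : X -> R) : set X :=
  [set x | forall U : set X, open U -> U x -> ~ (f = cst 0 %[ae mu in U])].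

Definition strongly_local : Prop :=
  forall f g, F f -> F g -> compact (esupport f) -> compact (esupport g) ->
    (exists U : set X, [/\ open U, esupport g `<=` U &
       exists c : R, f = cst c %[ae mu in U]]) ->
    E f g = 0.

Variable P : R -> (X -> R) -> (X -> R).

Definition is_generator (f h : X -> R) : Prop :=
  [/\ f \in Lfun mu 2%:E, h \in Lfun mu 2%:E &
      l2norm (fun x => t^-1 * (P t f x - f x) - h x) @[t --> (0 : R)^'+]
        --> (0 : R)%:E].

(* The strongly continuous symmetric contraction semigroup whose generator [L]
   is the self-adjoint operator of [(E, F)]: [f] is in the domain of [L] with
   [L f = h] iff [f] is in [F] and [E(f, g) = - <h, g>] for all [g] in [F]. *)
Record heat_semigroup : Prop := {
  hs_L2 : forall t f, 0 < t -> f \in Lfun mu 2%:E -> P t f \in Lfun mu 2%:E ;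
  hs_lin : forall t (a : R) f g, 0 < t ->
    f \in Lfun mu 2%:E -> g \in Lfun mu 2%:E ->
    P t (fun x => a * f x + g x) = (fun x => a * P t f x + P t g x) %[ae mu] ;
  hs_contraction : forall t f, 0 < t -> f \in Lfun mu 2%:E ->
    (l2norm (P t f) <= l2norm f)%E ;
  hs_sym : forall t f g, 0 < t -> f \in Lfun mu 2%:E -> g \in Lfun mu 2%:E ->
    l2dot (P t f) g = l2dot f (P t g) ;
  hs_semigroup : forall s t f, 0 < s -> 0 < t -> f \in Lfun mu 2%:E ->
    P (s + t) f = P s (P t f) %[ae mu] ;
  hs_continuous : forall f, f \in Lfun mu 2%:E ->
    l2norm (P t f \- f) @[t --> (0 : R)^'+] --> (0 : R)%:E ;
  hs_generator : forall f h, f \in Lfun mu 2%:E -> h \in Lfun mu 2%:E ->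
    is_generator f h <-> F f /\ forall g, F g -> E f g = - l2dot h g }.

Variable k : R -> X -> X -> R.

Definition continuous_heat_kernel : Prop :=
  forall t, 0 < t ->
    [/\ forall x y, 0 <= k t x y,
        continuous (fun z : X * X => k t z.1 z.2) &
        forall f, f \in Lfun mu 2%:E ->
          P t f = (fun x => \int[mu]_y (k t x y * f y)) %[ae mu]].

End Form.

Section Kernel.
Variable k : R -> X -> X -> R.

Definition sub_gaussian_bounds (dH dW : R) : Prop :=
  exists c3 c4 c5 c6 : R, [/\ 0 < c3, 0 < c4, 0 < c5, 0 < c6 &
    forall t : R, 0 < t ->
      {ae (mu \x mu)%E, forall z : borel X * borel X,
        let prof c c' := c * t `^ (- (dH / dW)) *
          expR (- (c' * ((mdist z.1 z.2 : R) `^ dW / t) `^ (dW - 1)^-1)) in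
        prof c5 c6 <= k t z.1 z.2 <= prof c3 c4}].

(* The action of the heat semigroup on bounded functions, defined at every
   point through the heat kernel. *)
Definition heat_op (t : R) (g : X -> R) (x : X) : R :=
  \int[mu]_y (k t x y * g y).

Definition bakry_emery (dW kappa : R) : Prop :=
  exists2 C : R, 0 < C &
    forall (t : R) (g : X -> R) (x y : X), 0 < t -> g \in Lfun mu +oo%E ->
      (`|heat_op t g x - heat_op t g y|%:E <=
       (C * (mdist x y `^ kappa / t `^ (kappa / dW)))%:E *
         'N[mu]_+oo[EFin \o g])%E.

Variable eta : R -> R -> R.

Definition subordinated_kernel (t : R) (x y : X) : \bar R :=
  (\int[lebesgue_measure]_(s in `]0%R, +oo[) (eta t s * k s x y)%:E)%E.

Definition besov_seminorm (p alpha : R) (f : X -> R) : \bar R :=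
  ereal_sup [set ((t `^ (- alpha))%:E *
      (\int[mu]_y \int[mu]_x
         ((`|f x - f y| `^ p)%:E * subordinated_kernel t x y)) `^ p^-1)%E
    | t in [set t : R | 0 < t]].

Definition besov (p alpha : R) : set (X -> R) :=
  [set f | f \in Lfun mu p%:E /\ (besov_seminorm p alpha f < +oo)%E].

End Kernel.

End MetricMeasureSpace.

(* The density of the [delta]-stable subordinator, characterised by its Laplace
   transform. *)
Definition subordinator_density {R : realType} (delta : R) (eta : R -> R -> R)
    : Prop :=
  forall t : R, 0 < t ->
    [/\ forall s, 0 < s -> 0 <= eta t s,
        {within `]0, +oo[, continuous (eta t)} &
        forall lambda : R, 0 < lambda ->
          (\int[lebesgue_measure]_(s in `]0%R, +oo[)
             (eta t s * expR (- (s * lambda)))%:E =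
           (expR (- (t * lambda `^ delta)))%:E)%E].

(* Main.v *)
From HB Require Import structures.
Require Import Defs.
From mathcomp Require Import all_boot all_order all_algebra.
From mathcomp Require Import all_classical all_reals all_analysis.
From mathcomp Require Import measurable_realfun ring lra.
Import Order.TTheory GRing.Theory Num.Theory.
Import numFieldNormedType.Exports.
Local Open Scope classical_set_scope.
Local Open Scope ring_scope.

(** Off the diagonal the subordinated kernel decays no faster than linearly as
[t -> 0]: for every [D] there are [c, t0 > 0] with [p_t(x, y) >= c t] whenever
[d(x, y) < D] and [0 < t < t0] ([subordinated_kernel_ge]). If the Besov
seminorm of [f] is finite, the double integral of [|f(x) - f(y)|^p p_t(x, y)]
is at most [M^p t^(alpha p)], so on each ball [B] the double integral over
[B x B] of [|f(x) - f(y)|^p] is at most a constant times [t^(alpha p - 1)].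
As [alpha p > 1], letting [t -> 0] shows that it vanishes
([besov_increments0]): [f] is a.e. constant on every ball, hence a.e. constant
on [X]. Since Ahlfors regularity at all scales gives [mu(X) = +oo], the only
constant in [L^p] is [0].

The linear lower bound combines two facts. First, by the sub-Gaussian lower
bound, [p_s(x, y) >= C e^(-s)] for all [s >= a] and [d(x, y) < D]
([sub_gaussian_ge]); it holds at every point and not only almost everywhere,
because the kernel is continuous and balls have positive measure
([ae_ge_everywhere]). Second, the mass that the subordinator puts away
from [s = 0] is at least linear in [t] ([stable_tail]). This is read off the
Laplace transform: with [u = 2^delta < c < 2] and [E = e^(-s)], the function
[c E - (c + 1) E^2 + E^4 = E (1 - E) (c - E - E^2)] is nonpositive for small
[s], while its integral against the density of the subordinator is
[c e^(-t) - (c + 1) e^(-t u) + e^(-t u^2) = (u - 1) (c - u) t + O(t^2)], whose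
linear coefficient is positive. *)

(** * Integrals of nonnegative functions *)

(** The integral of a nonnegative function is a supremum over the simple
functions below it, so monotonicity holds for arbitrary functions. Integrals
involving [s |-> k s x y] or the subordinated kernel can thus be compared with
others without discussing their measurability. *)
Lemma ge0_le_integral_nomeas d (T : measurableType d) (R : realType)
    (mu : {measure set T -> \bar R}) (D : set T) (f g : T -> \bar R) :
  (forall x, D x -> 0 <= f x)%E -> (forall x, D x -> f x <= g x)%E ->
  (\int[mu]_(x in D) f x <= \int[mu]_(x in D) g x)%E.
Proof.
move=> f0 fg.
have g0 x : D x -> (0 <= g x)%E.
  by move=> Dx; apply: (le_trans (f0 _ Dx)); exact: fg.
rewrite !ge0_integralE//; apply: ereal_sup_le => /= _ -[h hf <-]; exists h => // x.
apply: le_trans (hf x) _; rewrite !patchE; case: ifPn => //.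
by rewrite inE => /fg.
Qed.

Lemma ge0_integral_ae0 d (T : measurableType d) (R : realType)
    (mu : {measure set T -> \bar R}) (g : T -> \bar R) :
  (forall x, 0 <= g x)%E -> {ae mu, forall x, g x = 0%E} ->
  (\int[mu]_x g x = 0)%E.
Proof.
move=> g0 [N [mN N0 sN]]; apply/eqP; rewrite eq_le integral_ge0// andbT.
have <- : (\int[mu]_(x in N) (cst +oo x) = 0)%E.
  by rewrite integral_cst// N0 mule0.
rewrite [leRHS]integral_mkcond; apply: ge0_le_integral_nomeas => // x _.
rewrite patchE; case: ifPn => [_|]; first by rewrite leey.
rewrite notin_setE => xN; apply: contrapT => gx; apply: xN; apply: sN => /= gx0.
by apply: gx; rewrite gx0.
Qed.

(** Tonelli's measurability statement for a measure that is merely known to be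
sigma-finite, without carrying the corresponding structure. *)
Lemma measurable_partial_integral d d' (T : measurableType d)
    (T' : measurableType d') (R : realType) (nu : {measure set T' -> \bar R})
    (g : T * T' -> \bar R) :
  sigma_finite [set: T'] nu -> measurable_fun [set: T * T'] g ->
  (forall z, 0 <= g z)%E ->
  measurable_fun [set: T] (fun x => \int[nu]_y g (x, y))%E.
Proof.
move=> sf mg g0.
pose H1 := isSFinite.Build _ _ _ _ (sfinite_measure_sigma_finite sf).
pose H2 := isSigmaFinite.Build _ _ _ _ sf.
pose nu' := HB.pack_for (SigmaFiniteMeasure.type T' R) (Measure.sort nu) H1 H2.
exact: (@measurable_fun_fubini_tonelli_F _ _ _ _ R nu' g mg g0).
Qed.

Lemma ae_exists d (T : measurableType d) (R : realType)
    (mu : {measure set T -> \bar R}) (A : set T) (P : T -> Prop) :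
  measurable A -> (0 < mu A)%E -> {ae mu, forall x, A x -> P x} ->
  exists2 x, A x & P x.
Proof.
move=> mA A0 [N [mN N0 sN]]; apply: contrapT => noP.
suff : (mu A <= 0)%E by rewrite leNgt A0.
rewrite -N0 le_measure ?inE// => x Ax; apply: sN => /= PAx.
by apply: noP; exists x => //; exact: PAx.
Qed.

(** * Functions in L^p *)

Lemma Lfun_measurable d (T : measurableType d) (R : realType)
    (mu : {measure set T -> \bar R}) (p : \bar R) (f : T -> R) :
  f \in Lfun mu p -> measurable_fun [set: T] f.
Proof. by move=> /sub_Lfun_mfun /set_mem. Qed.

Lemma ae0_Lfun d (T : measurableType d) (R : realType)
    (mu : {measure set T -> \bar R}) (p : R) (f : T -> R) :
  0 < p -> measurable_fun [set: T] f -> f = cst 0 %[ae mu] ->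
  f \in Lfun mu p%:E.
Proof.
move=> p0 mf f0; apply/andP; split; rewrite inE//=.
rewrite /finite_norm unlock /Lnorm.
rewrite ge0_integral_ae0 ?poweR0r ?invr_neq0 ?gt_eqF//.
  by move=> x; exact: poweR_ge0.
apply: filterS f0 => x /(_ I) /= ->.
by rewrite normr0 powR0 ?gt_eqF.
Qed.

Lemma Lfun_cst_eq0 d (T : measurableType d) (R : realType)
    (mu : {measure set T -> \bar R}) (p : R) (f : T -> R) (c : R) :
  0 < p -> mu [set: T] = +oo%E -> f \in Lfun mu p%:E -> f = cst c %[ae mu] ->
  c = 0.
Proof.
move=> p0 muT fp fc; apply: contrapT => /eqP c0.
have mf := @Lfun_measurable _ _ _ _ _ _ fp.
have /andP[_] := fp; rewrite inE/= /finite_norm unlock /Lnorm.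
rewrite (@ae_eq_integral _ _ R mu setT (cst (`|c| `^ p)%:E))//.
- rewrite integral_cst// muT gt0_muley ?lte_fin ?powR_gt0 ?normr_gt0//.
  by rewrite poweRyr// invr_neq0// gt_eqF.
- apply: (@measurableT_comp _ _ _ _ _ _ (fun x : \bar R => x `^ p)%E).
    exact: measurable_poweR.
  by apply: measurableT_comp => //; exact/measurable_EFinP.
- by apply: filterS fc => x /(_ I) /= ->.
Qed.

(** * The stable subordinator for small times *)

Lemma expRN_le_sqr (R : realType) (x : R) : 0 <= x ->
  expR (- x) <= 1 - x + x ^+ 2.
Proof.
move=> x0; rewrite expRN -div1r ler_pdivrMr ?expR_gt0//.
apply: (@le_trans _ _ ((1 - x + x ^+ 2) * (1 + x))); first by nra.
by rewrite ler_wpM2l ?expR_ge1Dx//; nra.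
Qed.

Lemma powR_gt1 (R : realType) (x r : R) : 1 < x -> 0 < r -> 1 < x `^ r.
Proof.
move=> x1 r0; have := @gt0_ltr_powR R r r0 1 x.
by rewrite powR1; apply=> //; rewrite nnegrE; lra.
Qed.

(** The difference [c E + E^4 - (c + 1) E^2 = E (1 - E) (c - E - E^2)] is at most
[2 E], and it is nonpositive for [s < (2 - c) / 3], where [E >= 1 - s] forces
[E + E^2 >= (1 - s) (2 - s) >= 2 - 3 s > c]. *)
Lemma exp_combination_le (R : realType) (c s : R) : 1 < c -> c < 2 -> 0 <= s ->
  c * expR (- s) + expR (- s) ^+ 4 <=
  2 * (expR (- s) * \1_(`[(2 - c) / 3, +oo[) s) + (c + 1) * expR (- s) ^+ 2.
Proof.
move=> c1 c2 s0; set a := (2 - c) / 3.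
have aE : 3 * a = 2 - c by rewrite /a; lra.
have E0 := expR_ge0 (- s).
have E1 : expR (- s) <= 1 by rewrite -expR0 ler_expR oppr_le0.
have Es := expR_ge1Dx (- s).
move: E0 E1 Es; set E := expR (- s) => E0 E1 Es.
have EE0 : 0 <= E ^+ 2 by rewrite sqr_ge0.
have EE1 : E ^+ 2 <= 1 by rewrite expr_le1.
rewrite indicE mem_setE in_itv/= andbT; have [sa|sa] := leP a s; rewrite /=.
  have : E ^+ 4 <= E ^+ 2.
    have -> : E ^+ 4 = E ^+ 2 * E ^+ 2 by ring.
    by rewrite ler_piMr.
  have : c * E <= 2 * E by rewrite ler_wpM2r// ltW.
  have : 0 <= c * E ^+ 2 by rewrite mulr_ge0//; lra.
  lra.
have cE : c <= E + E ^+ 2.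
  have : (1 - a) * (1 - a) <= E * E by apply: ler_pM; lra.
  by rewrite expr2; have := sqr_ge0 a; rewrite expr2; lra.
have : 0 <= E * (1 - E) * (E + E ^+ 2 - c) by rewrite !mulr_ge0; lra.
have -> : E * (1 - E) * (E + E ^+ 2 - c) =
  (c + 1) * E ^+ 2 - c * E - E ^+ 4 by ring.
lra.
Qed.

Lemma measurable_subordinator_mul (R : realType) (delta t : R)
    (eta : R -> R -> R) (g : R -> R) :
  subordinator_density delta eta -> 0 < t ->
  measurable_fun [set: measurableTypeR R] g ->
  measurable_fun (`]0%R, +oo[%classic : set (measurableTypeR R))
    (fun s => (eta t s * g s)%:E).
Proof.
move=> etaP t0 mg; have [_ etac _] := etaP t t0.
apply/measurable_EFinP; apply: measurable_funM; last exact: measurable_funTS.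
by apply: subspace_continuous_measurable_fun.
Qed.

(** The first-order Taylor coefficient at [t = 0] of the Laplace transform of
the combination in [exp_combination_le] is [m = (u - 1) (c - u) > 0] with
[u = 2^delta]; halving it absorbs the quadratic error when [t < m / 24]. *)
Lemma stable_tail (R : realType) (delta : R) (eta : R -> R -> R) :
  0 < delta -> delta < 1 -> subordinator_density delta eta ->
  exists a c t0 : R, [/\ 0 < a, 0 < c, 0 < t0 & forall t, 0 < t -> t < t0 ->
    ((c * t)%:E <= \int[lebesgue_measure]_(s in `]0%R, +oo[)
        (eta t s * (expR (- s) * \1_(`[a, +oo[) s))%:E)%E].
Proof.
move=> d0 d1 etaP.
pose u : R := 2 `^ delta.
have u1 : 1 < u by apply: powR_gt1 => //; lra.
have u2 : u < 2.
  have : 1 < (2:R) `^ (1 - delta) by apply: powR_gt1; lra.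
  have : u * 2 `^ (1 - delta) = 2.
    rewrite /u -powRD; first by rewrite subrKC powRr1; lra.
    by apply/implyP => _; lra.
  by set v := 2 `^ (1 - delta); nra.
pose c := (u + 2) / 2; pose a := (2 - c) / 3; pose m := (u - 1) * (c - u).
have [cu c2] : u < c /\ c < 2 by rewrite /c; lra.
have a0 : 0 < a by rewrite /a; lra.
have m0 : 0 < m by rewrite /m; nra.
exists a, (m / 4), (m / 24); split; [done|lra|lra|] => t t0 tm.
have [eta0 _ etaL] := etaP t t0.
pose D : set (measurableTypeR R) := `]0%R, +oo[%classic.
have mD : measurable D by exact: measurable_itv.
pose e l s := (eta t s * expR (- (s * l)))%:E.
pose h s := (eta t s * (expR (- s) * \1_(`[a, +oo[) s))%:E.
have s0 (s : R) : D s -> 0 < s.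
  by rewrite /D/= in_itv/= andbT.
have e0 l s : D s -> (0 <= e l s)%E.
  by move=> /s0 ?; rewrite /e lee_fin mulr_ge0 ?expR_ge0 ?eta0.
have me l : measurable_fun D (e l).
  apply: (measurable_subordinator_mul _ _ _ _ _ etaP t0).
  by do 2 apply: measurableT_comp => //; exact: measurable_funM.
have h0 s : D s -> (0 <= h s)%E.
  by move=> /s0 ?; rewrite /h lee_fin !mulr_ge0 ?expR_ge0 ?eta0// indicE ler0n.
have mh : measurable_fun D h.
  apply: (measurable_subordinator_mul _ _ _ _ _ etaP t0).
  apply: measurable_funM; last exact: measurable_indic.
  by apply: measurableT_comp.
have pointwise s : D s ->
    (c%:E * e 1%R s + e 4%R s <= 2%:E * h s + (c + 1)%:E * e 2%R s)%E.
  move=> /s0 sgt0; rewrite /e /h -!EFinM -!EFinD lee_fin.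
  have -> : expR (- (s * 4)) = expR (- s) ^+ 4.
    by rewrite -expRM_natl mulrN mulrC.
  have -> : expR (- (s * 2)) = expR (- s) ^+ 2.
    by rewrite -expRM_natl mulrN mulrC.
  have := @exp_combination_le _ c s ltac:(lra) c2 (ltW sgt0).
  by move=> /(ler_wpM2l (eta0 s sgt0)); rewrite mulr1 -/a; lra.
have cge0 : (0 <= c%:E)%E by rewrite lee_fin; lra.
have c1ge0 : (0 <= (c + 1)%:E)%E by rewrite lee_fin; lra.
have two0 : (0 <= 2%:E :> \bar R)%E by rewrite lee_fin; lra.
have lhs0 s : D s -> (0 <= c%:E * e 1%R s + e 4%R s)%E.
  by move=> Ds; rewrite adde_ge0 ?mule_ge0 ?e0.
have := @ge0_le_integral_nomeas _ _ R lebesgue_measure _ _ _ lhs0 pointwise.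
have mZ (r : R) (f : measurableTypeR R -> \bar R) :
    measurable_fun D f -> measurable_fun D (fun s => r%:E * f s)%E.
  by move=> mf; apply: measurable_funeM.
have Z0 (r : R) (f : measurableTypeR R -> \bar R) :
    (0 <= r%:E)%E -> (forall s, D s -> 0 <= f s)%E ->
    forall s, D s -> (0 <= r%:E * f s)%E.
  by move=> r0 f0 s Ds; rewrite mule_ge0// f0.
have ID := @ge0_integralD _ _ R lebesgue_measure D mD.
have IZ := @ge0_integralZl _ _ R lebesgue_measure D mD.
rewrite (ID _ _ (Z0 _ _ cge0 (e0 _)) (mZ _ _ (me _)) (e0 _) (me _)).
rewrite (ID _ _ (Z0 _ _ two0 h0) (mZ _ _ mh) (Z0 _ _ c1ge0 (e0 _)) (mZ _ _ (me _))).
rewrite !(IZ _ (me _) _ (e0 _))// (IZ _ mh _ h0)//.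
rewrite /e !etaL; [|lra..].
rewrite powR1 mulr1 -/u.
have -> : (4:R) `^ delta = u * u.
  by rewrite /u -powRM; [congr (_ `^ _); lra|lra|lra].
set H := (\int[_]_(_ in _) _)%E.
case: H => [H | |]; last by rewrite mulrNy gtr0_sg// mul1e.
  rewrite -!EFinM -!EFinD !lee_fin => key.
  have k1 := expR_ge1Dx (- t).
  have k4 := expR_ge1Dx (- (t * (u * u))).
  have k2 : expR (- (t * u)) <= 1 - t * u + (t * u) ^+ 2.
    by apply: expRN_le_sqr; nra.
  have b1 : c * (1 - t) <= c * expR (- t) by rewrite ler_wpM2l; lra.
  have b2 : (c + 1) * expR (- (t * u)) <= (c + 1) * (1 - t * u + (t * u) ^+ 2).
    by rewrite ler_wpM2l; lra.
  (* the second-order error is at most [12 t^2], which [t < m / 24] turns into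
     half of the main term *)
  have b3 : t * m - (c + 1) * (t * u) ^+ 2 <= 2 * H by rewrite /m; lra.
  have b4 : (c + 1) * (t * u) ^+ 2 <= 12 * t ^+ 2.
    rewrite exprMn mulrCA mulrC ler_wpM2r ?sqr_ge0//.
    have : u ^+ 2 <= 4 by rewrite expr2; nra.
    by have := sqr_ge0 u; nra.
  have b5 : 12 * t ^+ 2 <= t * m / 2 by rewrite expr2; nra.
  lra.
by rewrite leey.
Qed.

(** * Lower bounds for the heat kernel *)

Lemma powR_le_expR (R : realType) (g s : R) : 0 < g -> 0 < s ->
  s `^ g <= expR (g * ln g) * expR s.
Proof.
move=> g0 s0; rewrite /powR gt_eqF// -expRD ler_expR.
have : ln (s / g) <= s / g by rewrite ltW// ln_sublinear// divr_gt0.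
rewrite ln_div ?posrE// => /(ler_wpM2l (ltW g0)).
by rewrite [leRHS]mulrC divfK ?gt_eqF//; lra.
Qed.

(** For [s >= a] the exponential factor of the profile is bounded below, since
[d^dW / s <= D^dW / a], and the polynomial factor dominates [e^(-s)]; the latter
rate is chosen to match the tail in [stable_tail]. *)
Lemma sub_gaussian_ge (R : realType) (c5 c6 dH dW a D : R) :
  0 < c5 -> 0 < c6 -> 0 < dH -> 2 <= dW -> 0 < a ->
  exists2 C : R, 0 < C & forall s d : R, a <= s -> 0 <= d -> d <= D ->
    C * expR (- s) <= c5 * s `^ (- (dH / dW)) *
      expR (- (c6 * ((d `^ dW / s) `^ (dW - 1)^-1))).
Proof.
move=> c50 c60 dH0 dW2 a0; set g := dH / dW.
have dW0 : 0 < dW by lra.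
have g0 : 0 < g by rewrite divr_gt0.
set K := c6 * ((D `^ dW / a) `^ (dW - 1)^-1).
exists (c5 * (expR (g * ln g))^-1 * expR (- K)).
  by rewrite !mulr_gt0 ?invr_gt0 ?expR_gt0.
move=> s d sa d0 dD; have s0 : 0 < s by lra.
rewrite mulrAC; apply: ler_pM; rewrite ?expR_ge0 ?mulr_ge0 ?invr_ge0 ?expR_ge0 ?(ltW c50)//.
  rewrite -mulrA ler_pM2l// powRN expRN -invfM lef_pV2 ?posrE ?mulr_gt0 ?expR_gt0 ?powR_gt0//.
  exact: powR_le_expR.
rewrite ler_expR lerN2 ler_pM2l// ge0_ler_powR ?nnegrE ?invr_ge0 ?divr_ge0 ?powR_ge0//; try lra.
rewrite ler_pM ?powR_ge0 ?invr_ge0 ?lef_pV2 ?posrE//; try lra.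
by rewrite ge0_ler_powR ?nnegrE; lra.
Qed.

Section MetricMeasureSpace.
Context {R : realType} {X : pmetricType R}.
Variable mu : {measure set (borel X) -> \bar R}.

Lemma open_mball (x : X) (r : R) : open (ball x r).
Proof.
rewrite openE => y; rewrite ballEmdist /= => xy; apply/nbhs_ballP.
exists (r - mdist x y) => /=; first by rewrite subr_gt0.
move=> z; rewrite !ballEmdist /= ltrBrDl; apply: le_lt_trans.
exact: metric_triangle.
Qed.

Lemma measurable_mball (x : X) (r : R) :
  measurable (ball x r : set (borel X)).
Proof. by apply: sub_sigma_algebra; exact: open_mball. Qed.

Lemma mu_ball_gt0 (dH : R) (x : X) (r : R) :
  ahlfors_regular mu dH -> 0 < r -> (0 < mu (ball x r))%E.
Proof.
move=> [c1 [c2 [c10 _ /(_ x r) mB]]] r0; have [mB1 _] := mB (ltW r0).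
by apply: lt_le_trans mB1; rewrite lte_fin mulr_gt0// powR_gt0.
Qed.

(** If a continuous [g] were below [v] at a pair of points at distance less than
[D], it would be so on a product of two small balls around them, of radius at
most half of the margin left to [D]. That product would lie in a null set, although its measure is
at least the product of the measures of the balls. *)
Lemma ae_ge_everywhere (dH : R) (g : X * X -> R) (v D : R) :
  ahlfors_regular mu dH -> continuous g ->
  {ae (mu \x mu)%E, forall z : borel X * borel X,
     (mdist z.1 z.2 : R) <= D -> v <= g z} ->
  forall x y, mdist x y < D -> v <= g (x, y).
Proof.
move=> A2 cg [A [mA A0 sA]] x y xyD; rewrite leNgt; apply/negP => gv.
have /nbhs_ballP[e /= e0 eg] : \forall z \near (x, y), g z < v.
  by have /cvgr_lt := cg (x, y); apply.
pose r := Num.min e ((D - mdist x y) / 2).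
have r0 : 0 < r by rewrite lt_min e0 divr_gt0// subr_gt0.
have inA x' y' : ball x r x' -> ball y r y' -> A (x', y').
  move=> xr yr; apply: sA => /= h; have : v <= g (x', y').
    apply: h; move: xr yr; rewrite !ballEmdist /= => xr yr.
    have r2 : r <= (D - mdist x y) / 2 by rewrite ge_min lexx orbT.
    have := metric_triangle x' x y'; have := metric_triangle x y y'.
    rewrite (metric_sym x' x); lra.
  apply/negP; rewrite -ltNge; apply: eg; split => /=.
    by apply: le_ball xr; rewrite ge_min lexx.
  by apply: le_ball yr; rewrite ge_min lexx.
have mBx := measurable_mball x r.
have : (0 < mu (ball y r) * mu (ball x r))%E.
  by rewrite mule_gt0 ?(mu_ball_gt0 _ _ _ A2).
rewrite -integral_cst// integral_mkcond ltNge => /negP; apply.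
rewrite -A0; apply: ge0_le_integral_nomeas => x' _.
  by rewrite patchE; case: ifP.
rewrite patchE; case: ifPn => [|_]; last exact: measure_ge0.
rewrite inE => xr /=.
apply: le_measure; rewrite ?inE.
- exact: measurable_mball.
- exact: measurable_xsection.
- by move=> y' yr; rewrite /xsection/= inE; exact: inA.
Qed.

Lemma ahlfors_sigma_finite (dH : R) : ahlfors_regular mu dH ->
  sigma_finite [set: borel X] mu.
Proof.
move=> [c1 [c2 [_ _ mB]]]; exists (fun n => ball (point : X) n%:R).
  apply/seteqP; split => // x _; exists (Num.bound (mdist (point : X) x)) => //.
  rewrite ballEmdist /=; apply: le_lt_trans (archi_boundP _) => //.
  exact: mdist_ge0.
move=> n; split; first exact: measurable_mball.
by have [_ /le_lt_trans] := mB point n%:R (ler0n _ _); apply; rewrite ltry.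
Qed.

Lemma ahlfors_setT (dH : R) : 0 < dH -> ahlfors_regular mu dH ->
  mu [set: X] = +oo%E.
Proof.
move=> dH0 [c1 [c2 [c10 _ mB]]]; apply/eqyP => r r0.
(* the radius at which the lower volume bound [c1 s^dH] equals [r] *)
pose s := (r / c1) `^ dH^-1.
have [le1 _] := mB point s (powR_ge0 _ _).
have -> : r = c1 * s `^ dH.
  rewrite /s -powRrM mulVf ?gt_eqF// powRr1; last by rewrite divr_ge0 ?ltW.
  by rewrite mulrC divfK ?gt_eqF.
apply: le_trans le1 _; apply: le_measure; rewrite ?inE//.
exact: measurable_mball.
Qed.

(** Only the times [s >= a] are used: there [sub_gaussian_ge] bounds [k s x y]
below by [C e^(-s)] uniformly in [d(x, y) < D], and [stable_tail] integrates
this against the density. *)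
Lemma subordinated_kernel_ge (k : R -> X -> X -> R) (eta : R -> R -> R)
    (dH dW delta D : R) :
  0 < dH -> ahlfors_regular mu dH -> 2 <= dW ->
  sub_gaussian_bounds mu k dH dW ->
  (forall t, 0 < t -> forall x y, 0 <= k t x y) ->
  (forall t, 0 < t -> continuous (fun z : X * X => k t z.1 z.2)) ->
  0 < delta -> delta < 1 -> subordinator_density delta eta ->
  exists c t0 : R, [/\ 0 < c, 0 < t0 & forall t x y, 0 < t -> t < t0 ->
    mdist x y < D -> ((c * t)%:E <= subordinated_kernel k eta t x y)%E].
Proof.
move=> dH0 A2 dW2 [c3 [c4 [c5 [c6 [_ _ c50 c60 HK]]]]] k0 ck d0 d1 etaP.
have [a [b [t0 [a0 b0 t00 tail]]]] := @stable_tail _ _ _ d0 d1 etaP.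
have [C C0 profC] := @sub_gaussian_ge R c5 c6 dH dW a D c50 c60 dH0 dW2 a0.
have kC s x y : a <= s -> mdist x y < D -> C * expR (- s) <= k s x y.
  move=> sa xyD; have s0 : 0 < s by lra.
  apply: (ae_ge_everywhere dH (fun z => k s z.1 z.2) _ D) => //.
    exact: ck.
  have [A [mA A0 sA]] := HK _ s0; exists A; split => // z /= zN; apply: sA => /=.
  move=> /andP[kz _]; apply: zN => zD; apply: le_trans kz.
  exact: profC (mdist_ge0 _ _) _.
exists (C * b), t0; split; [exact: mulr_gt0|done|] => t x y tgt0 tlt xyD.
have [eta0 _ _] := etaP t tgt0.
have s0 (s : R) : `]0, +oo[%classic s -> 0 < s by rewrite /= in_itv/= andbT.
pose h s := (eta t s * (expR (- s) * \1_(`[a, +oo[) s))%:E.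
have h0 s : `]0, +oo[%classic s -> (0 <= h s)%E.
  by move=> /s0 ?; rewrite /h lee_fin !mulr_ge0 ?expR_ge0 ?eta0// indicE ler0n.
apply: (@le_trans _ _ (\int[lebesgue_measure]_(s in `]0%R, +oo[) (C%:E * h s)))%E.
  rewrite ge0_integralZl//; last by rewrite lee_fin ltW.
  - by rewrite -mulrA EFinM lee_wpmul2l ?lee_fin ?(ltW C0)//; exact: tail.
  - apply: (measurable_subordinator_mul _ _ _ _ _ etaP tgt0).
    apply: measurable_funM; last exact: measurable_indic.
    by apply: measurableT_comp.
apply: ge0_le_integral_nomeas => s Ds.
  by rewrite mule_ge0 ?h0// lee_fin ltW.
have ? := s0 s Ds.
rewrite /h -EFinM lee_fin mulrCA ler_wpM2l ?eta0//.
rewrite indicE mem_setE in_itv/= andbT; have [sa|_] := leP a s; rewrite /=.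
  by rewrite mulr1 kC.
by rewrite !mulr0 k0.
Qed.

(** * Vanishing increments *)

(** Of the two restrictions to [B], the one on [x] is an indicator, so that the
inner integral runs over the whole space and Tonelli applies to a function that
is measurable on the product; the one on [y] is left to the domain of the outer
integral. *)
Definition increments (f : X -> R) (p : R) (B : set X) (y x : X) : \bar R :=
  (`|f x - f y| `^ p * \1_B x)%:E.

Section Increments.
Variables (f : X -> R) (p : R) (B : set (borel X)).
Hypotheses (sf : sigma_finite [set: borel X] mu)
  (mf : measurable_fun [set: borel X] f) (mB : measurable B).

Lemma increments_ge0 y x : (0 <= increments f p B y x)%E.
Proof. by rewrite lee_fin mulr_ge0 ?powR_ge0// indicE ler0n. Qed.

Lemma measurable_increments :
  measurable_fun [set: borel X * borel X] (fun z => increments f p B z.1 z.2).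
Proof.
apply/measurable_EFinP; apply: measurable_funM.
  apply: (@measurableT_comp _ _ _ _ _ _ (fun u : R => u `^ p)).
    exact: measurable_powR.
  apply: measurableT_comp => //; apply: measurable_funB.
    by apply: measurableT_comp.
  by apply: measurableT_comp.
by apply: (@measurableT_comp _ _ _ _ _ _ (\1_B : borel X -> R)).
Qed.

Lemma measurable_integral_increments :
  measurable_fun [set: borel X] (fun y => \int[mu]_x increments f p B y x)%E.
Proof.
apply: (measurable_partial_integral _ _ (borel X) (borel X) R mu
  (fun z => increments f p B z.1 z.2) sf measurable_increments).
by move=> z; exact: increments_ge0.
Qed.

(** By Tonelli the inner integral vanishes for almost every [y] in [B]; since
[B] has positive measure, one such [y] can be fixed, and [f = f y] a.e. on
[B]. *)
Lemma increments0_ae_cst : (0 < mu B)%E ->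
  (\int[mu]_(y in B) \int[mu]_x increments f p B y x = 0)%E ->
  exists c, f = cst c %[ae mu in B].
Proof.
move=> B0 J0.
have mG := measurable_integral_increments.
have G0 y : (0 <= \int[mu]_x increments f p B y x)%E.
  by apply: integral_ge0 => x _; exact: increments_ge0.
have : ae_eq mu B (fun y => \int[mu]_x increments f p B y x)%E (cst 0%E).
  apply/ae_eq_integral_abs => //; first exact: measurable_funTS.
  by rewrite -[RHS]J0; apply: eq_integral => y _; rewrite gee0_abs.
move=> /(ae_exists _ _ _ _ _ _ mB B0)[y By Gy].
have mh : measurable_fun [set: borel X] (increments f p B y).
  exact: (measurableT_comp measurable_increments
    (@measurable_pair1 _ _ (borel X) (borel X) y)).
have : ae_eq mu setT (increments f p B y) (cst 0%E).
  apply/ae_eq_integral_abs => //.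
  by rewrite -[RHS]Gy; apply: eq_integral => x _; rewrite gee0_abs// increments_ge0.
move=> ae0; exists (f y); apply: filterS ae0 => x /(_ I) + Bx.
rewrite /increments indicE mem_set// mulr1 => -[/powR_eq0_eq0/eqP].
by rewrite normr_eq0 subr_eq0 => /eqP.
Qed.

End Increments.

(** Concentric balls share a ball of positive measure, so the constants agree. *)
Lemma ae_cst_of_balls (dH : R) (f : X -> R) : ahlfors_regular mu dH ->
  (forall (z : X) r, 0 < r -> exists c, f = cst c %[ae mu in ball z r]) ->
  exists c, f = cst c %[ae mu].
Proof.
have aeF := ae_filter_ringOfSetsType mu.
move=> A2 /(_ point) fB.
have [c fc] := choice (fun n : nat => fB n.+1%:R (ltr0Sn _ n)).
exists (c 0%N).
have cE n : c n = c 0%N.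
  have B0 : (0 < mu (ball (point : X) 1%:R))%E by exact: (mu_ball_gt0 _ _ _ A2).
  have [|x _ [<- <-]] := ae_exists _ _ _ mu _ (fun x => f x = c n /\ f x = c 0%N)
    (measurable_mball _ _) B0; last by [].
  apply: filterS2 (fc n) (fc 0%N) => x h1 h2 Bx; split; last exact: h2.
  by apply: h1; apply: le_ball Bx; rewrite ler_nat.
have : \forall x \ae mu, forall n, ball (point : X) n.+1%:R x -> f x = c n.
  exact/ae_foralln.
apply: filterS => x h _ /=.
rewrite -(cE (Num.bound (mdist (point : X) x))); apply: h.
rewrite ballEmdist /=; apply: lt_trans (archi_boundP _) _; first exact: mdist_ge0.
by rewrite ltr_nat.
Qed.

(** * Besov functions *)

Section Besov.
Variables (k : R -> X -> X -> R) (eta : R -> R -> R).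
Hypothesis k0 : forall t, 0 < t -> forall x y, 0 <= k t x y.
Hypothesis eta0 : forall t, 0 < t -> forall s, 0 < s -> 0 <= eta t s.

Lemma subordinated_kernel_ge0 t x y : 0 < t ->
  (0 <= subordinated_kernel k eta t x y)%E.
Proof.
move=> t0; apply: integral_ge0 => s; rewrite /= in_itv/= andbT => s0.
by rewrite lee_fin mulr_ge0 ?k0 ?eta0.
Qed.

Lemma besov_ae0 (p alpha : R) (f : X -> R) : 0 < p ->
  measurable_fun [set: borel X] f -> f = cst 0 %[ae mu] ->
  besov mu k eta p alpha f.
Proof.
move=> p0 mf f0; split; first exact: ae0_Lfun.
apply: (@le_lt_trans _ _ 0%E) => //; apply: ge_ereal_sup => _ [t /= t0 <-].
have h0 x y : (0 <= (`|f x - f y| `^ p)%:E * subordinated_kernel k eta t x y)%E.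
  by rewrite mule_ge0 ?subordinated_kernel_ge0// lee_fin powR_ge0.
rewrite ge0_integral_ae0.
- by rewrite poweR0r ?mule0// invr_neq0// gt_eqF.
- by move=> y; apply: integral_ge0.
- apply: (@filterS _ _ (ae_filter_ringOfSetsType mu) _ _ _ f0).
  move=> y /(_ I) /= fy.
  apply: ge0_integral_ae0 => //.
  apply: (@filterS _ _ (ae_filter_ringOfSetsType mu) _ _ _ f0).
  move=> x /(_ I) /= fx.
  by rewrite fx fy subrr normr0 powR0 ?mul0e// gt_eqF.
Qed.

(** The bound [c t <= p_t] on pairs at distance less than [2 r] applies to all
pairs of points of a ball of radius [r]. With [J] the double integral and [M] the
seminorm it yields [c J <= M^p t^(alpha p - 1)] for all small [t], whose
right-hand side tends to [0]. *)
Lemma besov_increments0 (p alpha c t0 r : R) (f : X -> R) (z : X) :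
  sigma_finite [set: borel X] mu ->
  0 < p -> p^-1 < alpha -> 0 < c -> 0 < t0 ->
  (forall t x y, 0 < t -> t < t0 -> mdist x y < r + r ->
    ((c * t)%:E <= subordinated_kernel k eta t x y)%E) ->
  besov mu k eta p alpha f ->
  (\int[mu]_(y in ball z r) \int[mu]_x increments f p (ball z r) y x = 0)%E.
Proof.
move=> sf p0 alphap c0 t00 kc [fp].
have mf := @Lfun_measurable _ _ _ _ _ _ fp.
have mB := measurable_mball z r.
set B := ball z r in mB *; set J := (\int[mu]_(y in B) _)%E.
set M := besov_seminorm _ _ _ _ _ _ => Moo.
pose J' t := (\int[mu]_y \int[mu]_x
  ((`|f x - f y| `^ p)%:E * subordinated_kernel k eta t x y))%E.
have J0 : (0 <= J)%E.
  by apply: integral_ge0 => y _; apply: integral_ge0 => x _; exact: increments_ge0.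
have JJ' t : 0 < t -> t < t0 -> ((c * t)%:E * J <= J' t)%E.
  move=> tgt0 tlt.
  have ct0 : (0 <= (c * t)%:E)%E by rewrite lee_fin mulr_ge0// ltW.
  have mG := measurable_integral_increments f p B sf mf mB.
  rewrite /J -ge0_integralZl//; last 2 first.
  - by apply: measurable_funTS.
  - by move=> y _; apply: integral_ge0 => x _; exact: increments_ge0.
  rewrite integral_mkcond; apply: ge0_le_integral_nomeas => y _.
    rewrite patchE; case: ifPn => // _; rewrite mule_ge0//.
    by apply: integral_ge0 => x _; exact: increments_ge0.
  rewrite patchE; case: ifPn => [|_]; last first.
    apply: integral_ge0 => x _.
    by rewrite mule_ge0 ?subordinated_kernel_ge0// lee_fin powR_ge0.
  rewrite inE => By; rewrite -ge0_integralZl//; last 2 first.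
  - exact: (measurableT_comp (measurable_increments f p B mf mB)
      (@measurable_pair1 _ _ (borel X) (borel X) y)).
  - by move=> x _; exact: increments_ge0.
  apply: ge0_le_integral_nomeas => x _.
    by rewrite mule_ge0 ?increments_ge0.
  rewrite /increments indicE; case: (boolP (x \in (B : set X))) => [|_]; last first.
    by rewrite mulr0 mule0 mule_ge0 ?subordinated_kernel_ge0// ?lee_fin ?powR_ge0.
  rewrite inE mulr1 => Bx; rewrite muleC lee_wpmul2l// ?lee_fin ?powR_ge0//.
  apply: kc => //; have := metric_triangle x z y; move: Bx By.
  rewrite /B !ballEmdist/= (metric_sym x z); lra.
have JM t : 0 < t -> t < t0 ->
    ((t `^ (- alpha))%:E * ((c * t)%:E * J) `^ p^-1 <= M)%E.
  move=> tgt0 tlt; apply: (@le_trans _ _ ((t `^ (- alpha))%:E * J' t `^ p^-1)%E).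
    rewrite lee_wpmul2l ?lee_fin ?powR_ge0//.
    have ctJ0 : (0 <= (c * t)%:E * J)%E.
      by rewrite mule_ge0// lee_fin mulr_ge0 ?ltW.
    have J'0 := le_trans ctJ0 (JJ' t tgt0 tlt).
    have p'0 : 0 <= p^-1 by rewrite invr_ge0 ltW.
    by apply: (gt0_ler_poweR p'0) (JJ' t tgt0 tlt); rewrite in_itv/= leey andbT.
  by apply: ereal_sup_ubound; exists t.
have [t1 t1t0 t10] : exists2 t1, t1 < t0 & 0 < t1 by exists (t0 / 2); lra.
(* [J = +oo] would make the seminorm infinite already at a single time *)
move: J0 JM; clear JJ'; case: J => [j||//]; last first.
  move=> _ /(_ t1 t10 t1t0).
  rewrite gt0_muley ?lte_fin ?mulr_gt0// poweRyr; last by rewrite invr_neq0// gt_eqF.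
  by rewrite gt0_muley ?lte_fin ?powR_gt0// leye_eq => /eqP MM; rewrite MM in Moo.
rewrite lee_fin => j0 JM; congr (_%:E); apply/eqP; rewrite eq_le j0 andbT.
have M0 : (0 <= M)%E.
  apply: le_trans (JM _ t10 t1t0).
  by rewrite mule_ge0 ?poweR_ge0// lee_fin powR_ge0.
have Mfin : M \is a fin_num by rewrite ge0_fin_numE.
pose m := fine M; have m0 : 0 <= m by exact: fine_ge0.
have jm t : 0 < t -> t < t0 -> c * j <= m `^ p * t `^ (alpha * p - 1).
  move=> tgt0 tlt; have := JM t tgt0 tlt.
  rewrite -(fineK Mfin) -(EFinM (c * t) j) poweR_EFin -EFinM lee_fin -/m => le1.
  have := @ge0_ler_powR _ p (ltW p0) _ _ _ _ le1.
  rewrite !nnegrE mulr_ge0 ?powR_ge0// => /(_ isT m0).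
  rewrite powRM ?powR_ge0// -!powRrM mulVf ?gt_eqF// powRr1; last first.
    by rewrite !mulr_ge0// ltW.
  rewrite mulNr powRN mulrC ler_pdivrMr ?powR_gt0// => le2.
  rewrite powRB; last by apply/implyP => _; rewrite gt_eqF.
  by rewrite powRr1 ?(ltW tgt0)// mulrA ler_pdivlMr// mulrAC.
rewrite leNgt; apply/negP => jgt0.
have q0 : 0 < alpha * p - 1 by rewrite subr_gt0 -(mulVf (lt0r_neq0 p0)) ltr_pM2r.
(* the summand [1] keeps the denominator positive when [m = 0] *)
have cj0 : 0 < c * j / (m `^ p + 1).
  by rewrite divr_gt0 ?mulr_gt0// ltr_wpDl ?powR_ge0.
have /cvgr_lt/(_ _ cj0) small := powR_cvg0 q0.
have [t [tgt0 tlt tsmall]] : exists t, [/\ 0 < t, t < t0 &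
    t `^ (alpha * p - 1) < c * j / (m `^ p + 1)].
  near (0 : R)^'+ => t; exists t; split; near: t.
  - exact: nbhs_right_gt.
  - exact: nbhs_right_lt.
  - exact: small.
have := jm t tgt0 tlt; rewrite leNgt => /negP; apply.
move: tsmall; rewrite ltr_pdivlMr ?ltr_wpDl ?powR_ge0//.
have := powR_gt0 (alpha * p - 1) tgt0; nra.
Unshelve. all: by end_near. Qed.

End Besov.
End MetricMeasureSpace.

Theorem proposition3p5 (R : realType) (X : pmetricType R)
  (mu : {measure set (borel X) -> \bar R})
  (E : (X -> R) -> (X -> R) -> R) (F : set (X -> R))
  (P : R -> (X -> R) -> (X -> R)) (k : R -> X -> X -> R)
  (dH dW kappa delta : R) (eta : R -> R -> R) (p alpha : R)
  (lcX : locally_compact [set: X])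
  (mu_radon : radon mu) (mu_supp : full_support mu)
  (EF : dirichlet_form mu E F) (PEF : heat_semigroup mu E F P)
  (A1 : forall (x : X) (r : R), compact (closure (ball x r)))
  (dH0 : 0 < dH) (A2 : ahlfors_regular mu dH)
  (A3_regular : regular_form mu E F) (A3_local : strongly_local mu E F)
  (Pk : continuous_heat_kernel mu P k)
  (dW2 : 2 <= dW) (HK : sub_gaussian_bounds mu k dH dW)
  (kappa_gt0 : 0 < kappa) (kappa_lt : kappa < dW)
  (kappaE : is_critical_exponent mu (dW - kappa))
  (BE : bakry_emery mu k dW kappa)
  (delta_gt0 : 0 < delta) (delta_lt1 : delta < 1)
  (etaP : subordinator_density delta eta)
  (p1 : 1 <= p) (alpha_gt : p^-1 < alpha) :
  forall f : X -> R,
    besov mu k eta p alpha f <->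
    (measurable_fun [set: borel X] f /\ f = cst 0 %[ae mu]).
Proof.
move=> f; have p0 : 0 < p by apply: lt_le_trans p1.
have k0 t : 0 < t -> forall x y, 0 <= k t x y by move=> /Pk[].
have ck t : 0 < t -> continuous (fun z : X * X => k t z.1 z.2) by move=> /Pk[].
have eta0 t : 0 < t -> forall s, 0 < s -> 0 <= eta t s by move=> /etaP[].
split=> [bf|[mf f0]]; last exact: besov_ae0.
have fp := bf.1; have mf := @Lfun_measurable _ _ _ _ _ _ fp.
split=> //.
have sf := ahlfors_sigma_finite _ _ A2.
have [c fc] : exists c, f = cst c %[ae mu].
  apply: (ae_cst_of_balls _ _ _ A2) => z r r0.
  have [c [t0 [c0 t00 kc]]] :=
    subordinated_kernel_ge _ _ _ _ _ _ (r + r) dH0 A2 dW2 HK k0 ck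
      delta_gt0 delta_lt1 etaP.
  apply: (increments0_ae_cst mu f p _ sf mf (measurable_mball z r)).
    exact: (mu_ball_gt0 mu dH z r A2 r0).
  exact: (besov_increments0 _ _ _ k0 eta0 _ _ _ _ _ _ _ sf p0 alpha_gt c0 t00 kc bf).
by rewrite -(Lfun_cst_eq0 _ _ _ _ _ _ _ p0 (ahlfors_setT _ _ dH0 A2) fp fc).
Qed.
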